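(* Let $n\in\{2,3\}$. There exists a nonnegative $f_0\in L^1\cap L^\infty(\mathbb{R}^n\times \mathbb{R}^n)$ such that: (i) $\iint_{\mathbb{R}^n\times \mathbb{R}^n} |v|^m f_0(x,v)\,dx\,dv<+\infty$ for some $m>n^2-n$; (ii) there is a constant $C_0$ such that $\iint_{\mathbb{R}^n\times \mathbb{R}^n} |v|^k f_0(x,v)\,dx\,dv\leq (C_0 k)^{k/n}$ for all $k\geq 1$; (iii) the density $\rho_0(x)=\int_{\mathbb{R}^n} f_0(x,v)\,dv$ satisfies $$\rho_0(x)=\omega_n \ln_-|x|,\quad \forall x\in \mathbb{R}^n.$$
   Context: $\omega_n$ denotes the volume of the unit ball of $\mathbb{R}^n$, and $\ln_- r=\max(-\ln r,0)$ denotes the negative part of the logarithm (with value $+\infty$ at $r=0$). *)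

(* Defs.v *)
From HB Require Import structures.
From mathcomp Require Import all_boot all_order all_algebra.
From mathcomp Require Import all_classical all_reals all_analysis.
Set Implicit Arguments.
Unset Strict Implicit.
Unset Printing Implicit Defensive.
Import Order.TTheory GRing.Theory Num.Theory.
Import numFieldNormedType.Exports.
Local Open Scope classical_set_scope.
Local Open Scope ring_scope.

(* R^n, with the Borel sigma-algebra generated by the coordinates. *)
Notation Rn R n := (n.-tuple (measurableTypeR R)).

Section lebesgue_Rn.
Context {R : realType}.

Definition consRn n (z : measurableTypeR R * Rn R n) : Rn R n.+1 :=
  [tuple of z.1 :: z.2].

Definition unconsRn n (x : Rn R n.+1) : measurableTypeR R * Rn R n :=
  (thead x, [tuple of behead x]).

Lemma consRnK n : cancel (@consRn n) (@unconsRn n).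
Proof.
by move=> [a t]; congr pair => //; apply: val_inj.
Qed.

Lemma measurable_consRn n : measurable_fun setT (@consRn n).
Proof. exact: measurable_cons. Qed.

Lemma measurable_unconsRn n : measurable_fun setT (@unconsRn n).
Proof.
apply: measurable_fun_pair; last exact: measurable_behead.
exact: measurable_tnth.
Qed.

(* Lebesgue measure on R^n, as the n-fold product of Lebesgue measure on R:
   R^0 carries the unit point mass and R^(n+1) is identified with R * R^n. *)
Fixpoint lebesgueRn (n : nat) : set (Rn R n) -> \bar R :=
  match n return set (Rn R n) -> \bar R with
  | 0%N => dirac ([tuple] : Rn R 0)
  | n'.+1 => pushforward (lebesgue_measure \x @lebesgueRn n')%E (@consRn n')
  end.

Lemma pushforward_consRn_sigma_finite n
    (mu : {sigma_finite_measure set (Rn R n) -> \bar R}) :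
  sigma_finite setT (pushforward (lebesgue_measure \x mu)%E (@consRn n)).
Proof.
have /sigma_finiteP[F [TF ndF Foo]] := sigma_finiteT (@lebesgue_measure R).
have /sigma_finiteP[G [TG ndG Goo]] := sigma_finiteT mu.
exists (fun i => @unconsRn n @^-1` (F i `*` G i)).
  apply/seteqP; split => // x _.
  have [k _ Fk] : (\bigcup_i F i) (thead x) by rewrite -TF.
  have [l _ Gl] : (\bigcup_i G i) [tuple of behead x] by rewrite -TG.
  exists (maxn k l) => //; split => /=.
    by move: (thead x) Fk; exact/subsetPset/ndF/leq_maxl.
  by move: Gl; apply/subsetPset/ndG/leq_maxr.
move=> i; have [mF Fi] := Foo i; have [mG Gi] := Goo i; split.
  rewrite -[X in measurable X]setTI; apply: measurable_unconsRn => //.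
  exact: measurableX.
rewrite /pushforward -comp_preimage.
have /funext -> : @unconsRn n \o @consRn n =1 id by exact: consRnK.
by rewrite preimage_id product_measure1E// lte_mul_pinfty// ge0_fin_numE.
Qed.

Lemma lebesgueRn_measure n :
  exists mu : {sigma_finite_measure set (Rn R n) -> \bar R},
    @lebesgueRn n = mu.
Proof.
elim: n => [|n [mu muE]].
  by exists (dirac ([tuple] : Rn R 0)).
pose q : {measure set _ -> \bar R} :=
  measure_function_pushforward__canonical__measure_function_Measure
    (@lebesgue_measure R \x mu)%E (@measurable_consRn n).
pose sfq := @Measure_isSigmaFinite.Build _ _ _ q
  (pushforward_consRn_sigma_finite mu).
pose q' : {sigma_finite_measure set _ -> \bar R} := HB.pack (Measure.sort q) sfq.
by exists q'; rewrite /= muE.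
Qed.

Let lebesgueRn0 n : @lebesgueRn n set0 = 0%E.
Proof. by have [mu ->] := lebesgueRn_measure n; rewrite measure0. Qed.

Let lebesgueRn_ge0 n A : (0 <= @lebesgueRn n A)%E.
Proof. by have [mu ->] := lebesgueRn_measure n; rewrite measure_ge0. Qed.

Let lebesgueRn_sigma_additive n : semi_sigma_additive (@lebesgueRn n).
Proof.
by have [mu ->] := lebesgueRn_measure n; exact: measure_semi_sigma_additive.
Qed.

HB.instance Definition _ n := isMeasure.Build _ _ _ (@lebesgueRn n)
  (@lebesgueRn0 n) (@lebesgueRn_ge0 n) (@lebesgueRn_sigma_additive n).

Let lebesgueRn_sigma_finite n : sigma_finite setT (@lebesgueRn n).
Proof. by have [mu ->] := lebesgueRn_measure n; exact: sigma_finiteT. Qed.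

HB.instance Definition _ n := Measure_isSigmaFinite.Build _ _ _ (@lebesgueRn n)
  (@lebesgueRn_sigma_finite n).

Lemma lebesgueRn_box n (A : 'I_n -> set R) :
    (forall i, measurable (A i : set (measurableTypeR R))) ->
  @lebesgueRn n [set x | forall i, A i (tnth x i)] =
  (\prod_(i < n) lebesgue_measure (A i))%E.
Proof.
elim: n A => [|n IH] A mA.
  rewrite big_ord0 /= diracE mem_set// => -[].
  by [].
rewrite big_ord_recl -(IH (fun i => A (lift ord0 i)))//.
rewrite -product_measure1E//; last first.
  rewrite (_ : [set _ | _] =
    \bigcap_(i in [set: 'I_n]) ((@tnth n R)^~ i @^-1` A (lift ord0 i))).
    apply: fin_bigcap_measurable => // i _; rewrite -[X in measurable X]setTI.
    exact: (@measurable_tnth _ (measurableTypeR R)).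
  by apply/seteqP; split => x /= h i; [move=> _|]; apply: h.
rewrite /= /pushforward; congr (_ _); apply/seteqP; split => -[a t] /=.
  move=> h; split; first exact: (h ord0).
  by move=> i; have := h (lift ord0 i); rewrite /consRn tnthS.
move=> [Aa At] i; have [->//|i0] := eqVneq i ord0.
rewrite eq_sym in i0; have [j -> _] := unlift_some i0.
by rewrite /consRn tnthS; exact: At.
Qed.

Definition enorm n (x : Rn R n) : R := Num.sqrt (\sum_(i < n) tnth x i ^+ 2).

Definition unit_ball_volume (n : nat) : \bar R :=
  lebesgueRn [set x : Rn R n | enorm x < 1].

(* lne 0 = -oo, so this is +oo at r = 0. *)
Definition ln_neg (r : R) : \bar R := maxe (- lne r%:E)%E 0%E.

End lebesgue_Rn.
Arguments lebesgueRn {R} n.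
Arguments unit_ball_volume R n : clear implicits.

(* Main.v *)
Require Import Defs.
From mathcomp Require Import all_boot all_order all_algebra.
From mathcomp Require Import all_classical all_reals all_analysis.
From mathcomp Require Import measurable_realfun ess_sup_inf.
Import Order.TTheory GRing.Theory Num.Theory.
Import numFieldNormedType.Exports.
Local Open Scope classical_set_scope.
Local Open Scope ring_scope.
Local Open Scope ereal_scope.

(** f0 is taken to be the indicator function of the region
      E = { (x, v) | |x| < exp (- |v|^n) } = { (x, v) | |v|^n < - ln |x| },
    and the whole proof consists in slicing E in the two directions.

    At fixed x the slice is the ball |v|^n < - ln |x|, whose volume is omega_n
    times the n-th power of its radius, that is, omega_n ln_- |x|
    ([integral_support_f0_v]).  At x = 0 it is the whole space, and both sides
    are infinite because omega_n > 0.

    At fixed v the slice is a ball of radius exp (- |v|^n), of volume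
    omega_n exp (- n |v|^n).  Tonelli's theorem therefore turns the k-th moment
    into omega_n times the integral of |v|^k exp (- n |v|^n).  One factor
    exp (- |v|^n) absorbs the power, since s^p exp (- s) <= p^p for p = k / n
    and s = |v|^n ([powR_expRN_le]); as n >= 2, at least one factor
    exp (- |v|^n) is left, and it is integrable
    ([integral_expR_enormX_lty]).  So every moment of order k >= 0 is at most
    M (k / n)^(k / n) with M independent of k ([ex_moment_support_f0_le]), and
    M <= M^k for k >= 1 puts this bound in the form (C0 k)^(k / n).  The order
    k = 0 gives integrability, and k = n^2 - n + 1 gives the first claim.

    The only geometric input is the behaviour of Lebesgue measure under
    dilations ([lebesgueRn_scale]); it follows from the uniqueness of Lebesgue
    measure on the line and of product measures, by induction on the
    dimension. *)

(** * Dilations *)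

Definition scaleRn {R : realType} {n} (r : R) (x : Rn R n) : Rn R n :=
  [tuple (r * tnth x i)%R | i < n].

Lemma measurable_scaleRn {R : realType} {n} (r : R) :
  measurable_fun setT (@scaleRn R n r).
Proof.
apply/measurable_fun_tnthP => i.
rewrite (_ : _ \o _ = (fun x => r * tnth x i)%R); last first.
  by apply/funext => x /=; rewrite tnth_mktuple.
apply: measurable_funM => //.
exact: (@measurable_tnth _ (measurableTypeR R)).
Qed.

(** The right-hand side is a measure that gives every interval its length. *)
Lemma lebesgue_measure_scale {R : realType} (r : R) (A : set R) :
  (0 < r)%R -> measurable A ->
  lebesgue_measure A = r%:E * lebesgue_measure ( *%R r @^-1` A).
Proof.
move=> r0 mA.
have mr : measurable_fun setT ( *%R r : measurableTypeR R -> measurableTypeR R).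
  exact: mulrl_measurable.
pose m := [the {measure set _ -> \bar R} of
  mscale (NngNum (ltW r0)) [the {measure set _ -> \bar R} of
  (measure_function_pushforward__canonical__measure_function_Measure
    (@lebesgue_measure R) mr)]].
rewrite -[RHS]/(m A); apply: lebesgue_measure_unique mA => // _ [[a b]] _ <-.
rewrite /m /= /mscale /= /pushforward.
have -> : *%R r @^-1` `]a, b] = `](r^-1 * a)%R, (r^-1 * b)%R]%classic.
  apply/seteqP; split => x /=; rewrite !in_itv /=;
    by rewrite ltr_pdivrMl// ler_pdivlMl.
rewrite !lebesgue_measure_itv /= !lte_fin ltr_pM2l ?invr_gt0//.
case: ifP => _; last by rewrite mule0.
by rewrite -!EFinB -EFinM -mulrBr mulVKf ?gt_eqF.
Qed.

Lemma scaleRn_consRn {R : realType} n (r : R)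
    (z : measurableTypeR R * Rn R n) :
  scaleRn r (consRn z) = consRn ((r * z.1)%R, scaleRn r z.2).
Proof.
apply: eq_from_tnth => i; rewrite /consRn /= tnth_mktuple.
by have [j ->|->] := unliftP ord0 i; rewrite ?tnthS ?tnth0 ?tnth_mktuple.
Qed.

(** Both sides are measures in A, so that induction on the dimension reduces the
    claim to rectangles, where the factor of dimension 1 and the factor of
    dimension n contribute r and r^n. *)
Lemma lebesgueRn_scale {R : realType} n (r : R) (A : set (Rn R n)) :
  (0 < r)%R -> measurable A ->
  lebesgueRn n A = (r ^+ n)%:E * lebesgueRn n (scaleRn r @^-1` A).
Proof.
move=> r0; elim: n A => [|n IH] A mA.
  rewrite expr0 mul1e; congr (lebesgueRn _ _).
  by apply/seteqP; split => x /=; rewrite (tuple0 (scaleRn _ _)) (tuple0 x).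
pose s (z : measurableTypeR R * Rn R n) : measurableTypeR R * Rn R n :=
  ((r * z.1)%R, scaleRn r z.2).
have ms : measurable_fun setT s.
  apply: measurable_fun_pair.
    apply: (measurableT_comp (@mulrl_measurable R setT r)); exact: measurable_fst.
  exact: (measurableT_comp (@measurable_scaleRn R n r) measurable_snd).
pose m := [the {measure set _ -> \bar R} of
  mscale (NngNum (exprn_ge0 n.+1 (ltW r0))) [the {measure set _ -> \bar R} of
  (measure_function_pushforward__canonical__measure_function_Measure
    (@lebesgue_measure R \x @lebesgueRn R n) ms)]].
have mcA : measurable (@consRn R n @^-1` A).
  by rewrite -[X in measurable X]setTI; apply: measurable_consRn.
have -> : lebesgueRn n.+1 A = m (@consRn R n @^-1` A).
  rewrite -[LHS]/((@lebesgue_measure R \x @lebesgueRn R n) (@consRn R n @^-1` A)).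
  apply: (@product_measure_unique _ _ _ _ _ _ _ m _ _ mcA) => B C mB mC.
  rewrite /m /= /mscale /= /pushforward /=.
  rewrite (_ : s @^-1` _ = ( *%R r @^-1` B) `*` (scaleRn r @^-1` C)); last first.
    by apply/seteqP; split => -[].
  rewrite product_measure1E; last 2 first.
    by rewrite -[X in measurable X]setTI; apply: mulrl_measurable.
    by rewrite -[X in measurable X]setTI; apply: measurable_scaleRn.
  rewrite (lebesgue_measure_scale _ _ r0 mB) (IH _ mC).
  by rewrite exprS EFinM muleACA.
rewrite /m /= /mscale /= /pushforward /=; congr (_ * (_ \x _) _).
by apply/seteqP; split => z /=; rewrite scaleRn_consRn.
Qed.

(** * Volumes of balls *)

Lemma measurable_enorm {R : realType} n : measurable_fun setT (@enorm R n).
Proof.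
apply: (@measurableT_comp _ _ _ _ _ _ (@Num.sqrt R)).
  apply: continuous_measurable_fun; exact: sqrt_continuous.
apply: measurable_sum => i; apply: measurable_funX.
exact: (@measurable_tnth _ (measurableTypeR R)).
Qed.

Lemma enorm_ge0 {R : realType} n (x : Rn R n) : (0 <= enorm x)%R.
Proof. exact: sqrtr_ge0. Qed.

Lemma enorm_scaleRn {R : realType} n (r : R) (x : Rn R n) :
  (0 <= r)%R -> enorm (scaleRn r x) = (r * enorm x)%R.
Proof.
move=> r0; rewrite /enorm; under eq_bigr do rewrite tnth_mktuple exprMn.
by rewrite -mulr_sumr sqrtrM ?sqr_ge0// sqrtr_sqr ger0_norm.
Qed.

Lemma ler_tnth_enorm {R : realType} n (x : Rn R n) (i : 'I_n) :
  (`|tnth x i| <= enorm x)%R.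
Proof.
rewrite -sqrtr_sqr ler_wsqrtr// (bigD1 i)//= lerDl.
by apply: sumr_ge0 => j _; rewrite sqr_ge0.
Qed.

Lemma measurable_set_ltr {d} {T : measurableType d} {R : realType}
    (f g : T -> R) : measurable_fun setT f -> measurable_fun setT g ->
  measurable [set x | (f x < g x)%R].
Proof.
move=> mf mg; rewrite [X in measurable X](_ : _ =
    (fun x => (f x < g x)%R) @^-1` [set true]); last by apply/seteqP; split.
by rewrite -[X in measurable X]setTI; apply: measurable_fun_ltr.
Qed.

Lemma measurable_enorm_lt {R : realType} n (r : R) :
  measurable [set x : Rn R n | (enorm x < r)%R].
Proof.
apply: measurable_set_ltr; first exact: measurable_enorm.
exact: measurable_cst.
Qed.

Lemma measurable_enormX_lt {R : realType} n (t : R) :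
  measurable [set v : Rn R n | (enorm v ^+ n < t)%R].
Proof.
apply: (measurable_set_ltr (fun v => enorm v ^+ n)%R); last first.
  exact: measurable_cst.
by apply: measurable_funX; exact: measurable_enorm.
Qed.

Lemma measurable_expRN_enormX {R : realType} n :
  measurable_fun setT (fun v : Rn R n => expR (- enorm v ^+ n)%R).
Proof.
apply: measurableT_comp => //; apply: measurableT_comp => //.
by apply: measurable_funX; exact: measurable_enorm.
Qed.

Lemma measurable_box {R : realType} n (A : set (measurableTypeR R)) :
  measurable A -> measurable [set x : Rn R n | forall i, A (tnth x i)].
Proof.
move=> mA; rewrite (_ : [set _ | _] =
  \bigcap_(i in [set: 'I_n]) ((@tnth n R)^~ i @^-1` A)).
  apply: fin_bigcap_measurable => // i _; rewrite -[X in measurable X]setTI.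
  exact: (@measurable_tnth _ (measurableTypeR R)).
by apply/seteqP; split => x /= h i; [move=> _|]; apply: h.
Qed.

Lemma unit_ball_volume_lty {R : realType} n : unit_ball_volume R n < +oo.
Proof.
pose I : set (measurableTypeR R) := `](-1)%R, 1%R[%classic.
have mI : measurable I by exact: measurable_itv.
apply: (@le_lt_trans _ _
    (lebesgueRn n [set x : Rn R n | forall i, I (tnth x i)])).
  apply: le_measure; rewrite ?inE.
  - exact: measurable_enorm_lt.
  - exact: measurable_box.
  - move=> x /= x1 i; rewrite /I /= in_itv/= -ltr_norml.
    exact: le_lt_trans (ler_tnth_enorm _ _ _) x1.
rewrite (@lebesgueRn_box _ _ (fun=> I))//.
under eq_bigr do rewrite lebesgue_measure_itv/= lte_fin gtrN// -EFinB.
by rewrite prodEFin ltry.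
Qed.

(** The unit ball contains the cube of half-side 1 / (n + 1), on which
    |x|^2 <= n / (n + 1) < 1. *)
Lemma unit_ball_volume_gt0 {R : realType} n : 0 < unit_ball_volume R n.
Proof.
pose d : R := (n.+1%:R^-1)%R.
have d0 : (0 < d)%R by rewrite invr_gt0.
pose I : set (measurableTypeR R) := `[(- d)%R, d]%classic.
have mI : measurable I by exact: measurable_itv.
apply: (@lt_le_trans _ _
    (lebesgueRn n [set x : Rn R n | forall i, I (tnth x i)])).
  rewrite (@lebesgueRn_box _ _ (fun=> I))//.
  under eq_bigr do rewrite lebesgue_measure_itv/= lte_fin gtrN// -EFinB.
  rewrite prodEFin lte_fin; apply: prodr_gt0 => i _.
  by rewrite opprK addr_gt0.
apply: le_measure; rewrite ?inE.
- exact: measurable_box.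
- exact: measurable_enorm_lt.
- move=> x /= xd; rewrite -sqrtr1 ltr_sqrt//.
  apply: (@le_lt_trans _ _ (\sum_(i < n) d)%R).
    apply: ler_sum => i _; have := xd i; rewrite /I /= in_itv/= -ler_norml => xid.
    rewrite -real_normK ?num_real// expr2 (le_trans (ler_piMr _ _))//.
    by rewrite (le_trans xid)// invf_le1// ler1n.
  rewrite sumr_const card_ord -mulr_natl ltr_pdivrMr// mul1r ltr_nat.
  exact: ltnSn.
Qed.

Lemma unit_ball_volume_ge0 {R : realType} n : 0 <= unit_ball_volume R n.
Proof. exact/ltW/unit_ball_volume_gt0. Qed.

Lemma unit_ball_volume_fin_num {R : realType} n :
  unit_ball_volume R n \is a fin_num.
Proof. by rewrite ge0_fin_numE ?unit_ball_volume_ge0 ?unit_ball_volume_lty. Qed.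

Lemma lebesgueRn_setT {R : realType} n : lebesgueRn n.+1 [set: Rn R n.+1] = +oo.
Proof.
rewrite (_ : setT = [set x : Rn R n.+1 | forall i, [set: R] (tnth x i)]); last first.
  by apply/seteqP; split.
rewrite (@lebesgueRn_box _ _ (fun=> setT))// big_const_ord.
rewrite -set_itvNyy lebesgue_measure_itv/=.
elim: n => [|n IH] /=; first by rewrite mule1.
by rewrite [X in _ * X]IH mulyy.
Qed.

Lemma lebesgueRn_ball {R : realType} n (r : R) : (0 < n)%N -> (0 <= r)%R ->
  lebesgueRn n [set x : Rn R n | (enorm x < r)%R] =
  (r ^+ n)%:E * unit_ball_volume R n.
Proof.
move=> n0; rewrite le_eqVlt => /predU1P[<-|r0].
  rewrite expr0n gtn_eqF// mul0e (_ : mkset _ = set0) ?measure0//.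
  by apply/seteqP; split => // x /=; rewrite ltNge enorm_ge0.
rewrite (lebesgueRn_scale _ _ _ r0 (measurable_enorm_lt _ _)); congr (_ * _).
congr (lebesgueRn _ _); apply/seteqP; split => x /=;
  by rewrite enorm_scaleRn ?ltW// gtr_pMr.
Qed.

(** For t < 0 the set is empty, whence the maximum. *)
Lemma lebesgueRn_enormX_lt {R : realType} n (t : R) : (0 < n)%N ->
  lebesgueRn n [set v : Rn R n | (enorm v ^+ n < t)%R] =
  unit_ball_volume R n * (Num.max t 0%R)%:E.
Proof.
move=> n0; have [t0|t0] := leP t 0%R.
  rewrite mule0 (_ : mkset _ = set0) ?measure0//.
  apply/seteqP; split => // v /=.
  by rewrite ltNge (le_trans t0)// exprn_ge0// enorm_ge0.
pose r : R := (t `^ n%:R^-1)%R.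
have r0 : (0 <= r)%R by exact: powR_ge0.
have rn : (r ^+ n)%R = t.
  by rewrite -powR_mulrn// -powRrM mulVf ?powRr1 ?ltW// pnatr_eq0 -lt0n.
rewrite -rn muleC -lebesgueRn_ball//; congr (lebesgueRn _ _).
by apply/seteqP; split => v /=; rewrite ltr_pXn2r// nnegrE ?enorm_ge0.
Qed.

(** * Integrability of exp (- |v|^n) *)

(** A discrete layer-cake bound: the term of index floor s already dominates
    exp (- s). *)
Lemma expR_le_nneseries {R : realType} (s : R) : (0 <= s)%R ->
  (expR (- s))%:E <=
  \sum_(j <oo) (expR (- j%:R) * \1_[set u : R | (u < j.+1%:R)%R] s)%:E.
Proof.
move=> s0; have /andP[js sj] := truncn_itv s0.
apply: (@le_trans _ _ (\sum_(0 <= j < (Num.truncn s).+1)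
  (expR (- j%:R) * \1_[set u : R | (u < j.+1%:R)%R] s)%:E)); last first.
  apply: nneseries_lim_ge => j _ _.
  by rewrite lee_fin mulr_ge0 ?expR_ge0.
rewrite big_nat_recr//= [X in (_ * X)%R]indicE mem_set// mulr1.
apply: (@le_trans _ _ (expR (- (Num.truncn s)%:R))%:E).
  by rewrite lee_fin ler_expR lerN2.
rewrite leeDr//; apply: sume_ge0 => j _.
by rewrite lee_fin mulr_ge0 ?expR_ge0.
Qed.

(** Since j + 1 <= 2 exp (j / 2), the series is dominated by a geometric one of
    ratio exp (- 1 / 2). *)
Lemma nneseries_expR_lty {R : realType} :
  \sum_(j <oo) (expR (- j%:R) * j.+1%:R : R)%:E < +oo.
Proof.
pose q : R := expR (- 2^-1)%R.
have q0 : (0 <= q)%R by exact: expR_ge0.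
have q1 : (`|q| < 1)%R by rewrite ger0_norm// expR_lt1 oppr_lt0 invr_gt0.
apply: (@le_lt_trans _ _ (\sum_(j <oo) (geometric 2%R q j)%:E)).
  apply: lee_nneseries => [j _ _|j _]; rewrite lee_fin.
    by rewrite mulr_ge0 ?expR_ge0.
  rewrite /geometric /= /q -expRM_natl.
  pose h : R := expR (j%:R / 2)%R.
  have h0 : (0 < h)%R by exact: expR_gt0.
  have -> : (expR (j%:R * - 2^-1) = h^-1)%R by rewrite mulrN expRN.
  have -> : (expR (- j%:R) = h^-1 * h^-1)%R.
    by rewrite -expRN -expRD -opprD -splitr.
  rewrite mulrAC ler_pM2r ?invr_gt0// mulrC ler_pdivrMr// -ler_pdivrMl//.
  apply: le_trans (expR_ge1Dx _).
  rewrite -(natr1 j) mulrDr mulr1 addrC lerD ?invf_le1 ?ler1n//.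
  by rewrite mulrC.
rewrite (_ : \sum_(_ <oo) _ = (2 / (1 - q) : R)%:E) ?ltry//.
apply/cvg_lim => //; apply: cvg_EFin.
  by apply: nearW => m; rewrite sumEFin.
rewrite (_ : _ \o _ = series (geometric 2%R q)).
  exact: cvg_geometric_series.
by apply/funext => m /=; rewrite sumEFin.
Qed.

(** Integrating the layer-cake bound term by term, the set |v|^n < j + 1 has
    volume omega_n (j + 1), which grows only linearly in j. *)
Lemma integral_expR_enormX_lty {R : realType} n : (0 < n)%N ->
  \int[lebesgueRn n]_v (expR (- enorm v ^+ n) : R)%:E < +oo.
Proof.
move=> n0.
pose B j : set (Rn R n) := [set v | (enorm v ^+ n < j.+1%:R)%R].
have mB j : measurable (B j) by exact: measurable_enormX_lt.
have muB j : lebesgueRn n (B j) = unit_ball_volume R n * j.+1%:R%:E.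
  by rewrite lebesgueRn_enormX_lt// max_l.
apply: (@le_lt_trans _ _ (\int[lebesgueRn n]_v
    \sum_(j <oo) (expR (- j%:R) * \1_(B j) v)%:E)).
  apply: ge0_le_integral => //.
  - by apply/measurable_EFinP; exact: measurable_expRN_enormX.
  - apply: ge0_emeasurable_sum => [j v _ _|j _].
      by rewrite lee_fin mulr_ge0 ?expR_ge0.
    apply/measurable_EFinP; apply: measurable_funM.
      exact: measurable_cst.
    exact: measurable_indic.
  - move=> v _; rewrite (le_trans (expR_le_nneseries _ _))//.
    by rewrite exprn_ge0// enorm_ge0.
rewrite integral_nneseries//; last first.
  move=> j; apply/measurable_EFinP; apply: measurable_funM.
    exact: measurable_cst.
  exact: measurable_indic.
under eq_eseriesr => j _.
  under eq_integral do rewrite EFinM.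
  rewrite ge0_integralZl//=; last first.
    by apply/measurable_EFinP; exact: measurable_indic.
  rewrite integral_indic// setIT [X in _ * X](muB j).
  rewrite muleCA -EFinM -(fineK (unit_ball_volume_fin_num n)).
  over.
rewrite nneseriesZl; last by move=> j _; rewrite lee_fin mulr_ge0 ?expR_ge0.
by rewrite lte_mul_pinfty ?nneseries_expR_lty// lee_fin fine_ge0//
  unit_ball_volume_ge0.
Qed.

(** * The two slicings of the support *)

(** The strict inequality in this exponential form, rather than
    |v|^n < - ln |x|, makes the slice at x = 0 the whole space without a case
    distinction on the logarithm of 0. *)
Definition support_f0 {R : realType} n : set (Rn R n * Rn R n) :=
  [set z | (enorm z.1 < expR (- enorm z.2 ^+ n))%R].

Lemma measurable_support_f0 {R : realType} n : measurable (@support_f0 R n).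
Proof.
apply: (measurable_set_ltr (fun z : Rn R n * Rn R n => enorm z.1)).
  exact: (measurableT_comp (@measurable_enorm R n) measurable_fst).
exact: (measurableT_comp (@measurable_expRN_enormX R n) measurable_snd).
Qed.

(** For x != 0, taking logarithms turns the slice into |v|^n < - ln |x|, which is
    empty when |x| >= 1. *)
Lemma integral_support_f0_v {R : realType} n (x : Rn R n) : (0 < n)%N ->
  \int[lebesgueRn n]_v (\1_(support_f0 n) (x, v) : R)%:E =
  unit_ball_volume R n * ln_neg (enorm x).
Proof.
case: n x => // n x _.
transitivity (lebesgueRn n.+1 [set v | support_f0 n.+1 (x, v)]).
  have /= := congr1 (@^~ x) (indic_fubini_tonelli_FE (lebesgueRn n.+1)
    (@measurable_support_f0 R n.+1)).
  by rewrite /fubini_F/= xsectionE.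
have [x0|x0] := eqVneq (enorm x) 0%R.
  have -> : ln_neg (enorm x) = +oo.
    by rewrite /ln_neg x0 le0_lneNy//= max_l ?leey.
  rewrite gt0_muley ?unit_ball_volume_gt0//.
  rewrite (_ : mkset _ = setT) ?lebesgueRn_setT//.
  by apply/seteqP; split => // v _; rewrite /support_f0/= x0 expR_gt0.
have {}x0 : (0 < enorm x)%R by rewrite lt_def x0 enorm_ge0.
rewrite /ln_neg lne_EFin// -EFinN -EFin_max -lebesgueRn_enormX_lt//.
congr (lebesgueRn _ _); apply/seteqP; split => v; rewrite /support_f0/=.
  by rewrite -[X in (X < _)%R](@lnK R) ?posrE// ltr_expR ltrNr.
by rewrite -[X in (_ -> X < _)%R](@lnK R) ?posrE// ltr_expR ltrNr.
Qed.

(** The slice is a ball of radius exp (- |v|^n). *)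
Lemma integral_support_f0_x {R : realType} n (v : Rn R n) : (0 < n)%N ->
  \int[lebesgueRn n]_x (\1_(support_f0 n) (x, v) : R)%:E =
  (expR (- enorm v ^+ n) ^+ n)%:E * unit_ball_volume R n.
Proof.
move=> n0; rewrite -lebesgueRn_ball ?expR_ge0//.
have /= := congr1 (@^~ v) (indic_fubini_tonelli_GE (lebesgueRn n)
  (@measurable_support_f0 R n)).
by rewrite /fubini_G/= ysectionE.
Qed.

(** * Moments *)

(** For p > 0, after raising to the power 1 / p this is s / p <= exp (s / p). *)
Lemma powR_expRN_le {R : realType} (p s : R) : (0 <= p)%R -> (0 <= s)%R ->
  (s `^ p * expR (- s) <= p `^ p)%R.
Proof.
rewrite le_eqVlt => /predU1P[<- s0|p0 s0].
  by rewrite !powRr0 mul1r expR_le1 oppr_le0.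
rewrite expRN ler_pdivrMr ?expR_gt0//.
have -> : (expR s = expR (s / p) `^ p)%R.
  by rewrite -expRM divfK// gt_eqF.
rewrite -powRM ?expR_ge0 ?(ltW p0)//.
apply: ge0_ler_powR; rewrite ?nnegrE ?(ltW p0) ?mulr_ge0 ?expR_ge0 ?(ltW p0)//.
rewrite -ler_pdivrMl// mulrC; apply: le_trans (expR_ge1Dx _).
by rewrite lerDr.
Qed.

(** One of the n factors exp (- |v|^n) absorbs the power of |v|, another one is
    kept, and the remaining n - 2 are at most 1. *)
Lemma powR_enorm_expR_le {R : realType} n (v : Rn R n) (k : R) :
  (2 <= n)%N -> (0 <= k)%R ->
  (enorm v `^ k * expR (- enorm v ^+ n) ^+ n <=
   (k / n%:R) `^ (k / n%:R) * expR (- enorm v ^+ n))%R.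
Proof.
case: n v => [|[|n]]// v _ k0; set N := n.+2; set s := (enorm v ^+ N)%R.
have s0 : (0 <= s)%R by rewrite exprn_ge0// enorm_ge0.
have -> : (enorm v `^ k = s `^ (k / N%:R))%R.
  by rewrite /s -powR_mulrn ?enorm_ge0// -powRrM mulrCA divff ?mulr1// pnatr_eq0.
apply: (@le_trans _ _ ((s `^ (k / N%:R) * expR (- s)) * expR (- s))%R).
  rewrite -mulrA ler_wpM2l ?powR_ge0// /N !exprS mulrA ler_piMr//.
  by rewrite exprn_ile1 ?expR_ge0// expR_le1 oppr_le0.
rewrite ler_wpM2r ?expR_ge0// powR_expRN_le//.
by rewrite divr_ge0.
Qed.

(** By Tonelli, integrating in x first; this leaves a single integral in v, in
    which the order k no longer appears after the pointwise bound. *)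
Lemma moment_support_f0_le {R : realType} n (k : R) : (2 <= n)%N -> (0 <= k)%R ->
  \int[lebesgueRn n \x lebesgueRn n]_z
    (enorm z.2 `^ k * \1_(support_f0 n) z)%:E <=
  ((k / n%:R) `^ (k / n%:R))%:E *
    (unit_ball_volume R n * \int[lebesgueRn n]_v (expR (- enorm v ^+ n))%:E).
Proof.
move=> n2 k0; have n0 : (0 < n)%N by exact: ltnW.
have w0 := @unit_ball_volume_ge0 R n.
have mexp := @measurable_expRN_enormX R n.
have mpow : measurable_fun setT (fun v : Rn R n => enorm v `^ k)%R.
  apply: (@measurableT_comp _ _ _ _ _ _ (@powR R ^~ k)).
    exact: measurable_powR.
  exact: measurable_enorm.
rewrite fubini_tonelli2; last 2 first.
- apply/measurable_EFinP; apply: measurable_funM.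
    exact: (measurableT_comp mpow measurable_snd).
  apply: measurable_indic; exact: measurable_support_f0.
- by move=> z; rewrite lee_fin mulr_ge0 ?powR_ge0.
have -> : fubini_G (lebesgueRn n)
    (fun z => (enorm z.2 `^ k * \1_(support_f0 n) z)%:E) =
    (fun v => (enorm v `^ k * expR (- enorm v ^+ n) ^+ n)%:E *
              unit_ball_volume R n).
  apply/funext => v; rewrite /fubini_G/=.
  under eq_integral do rewrite EFinM.
  rewrite ge0_integralZl_EFin ?powR_ge0//; last first.
    apply/measurable_EFinP.
    have := @measurable_indic _ _ R setT _ (@measurable_support_f0 R n).
    by move=> h; apply: (measurableT_comp h); exact: measurable_pair2.
  by rewrite [X in _ * X]integral_support_f0_x// muleA EFinM.
rewrite ge0_integralZr//; last 2 first.
- apply/measurable_EFinP; apply: measurable_funM => //.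
  exact: measurable_funX.
- by move=> v _; rewrite lee_fin mulr_ge0 ?powR_ge0// exprn_ge0// expR_ge0.
rewrite [leRHS]muleCA [leRHS]muleC lee_wpmul2r//.
rewrite -ge0_integralZl_EFin ?powR_ge0//; last exact/measurable_EFinP.
apply: ge0_le_integral => //.
- by move=> v _; rewrite lee_fin mulr_ge0 ?powR_ge0// exprn_ge0// expR_ge0.
- apply/measurable_EFinP; apply: measurable_funM => //.
  exact: measurable_funX.
- by apply/measurable_EFinP; apply: measurable_funM.
- by move=> v _; rewrite -EFinM lee_fin powR_enorm_expR_le.
Qed.

Lemma ex_moment_support_f0_le {R : realType} n : (2 <= n)%N ->
  exists2 M : R, (1 <= M)%R & forall k : R, (0 <= k)%R ->
  \int[lebesgueRn n \x lebesgueRn n]_z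
    (enorm z.2 `^ k * \1_(support_f0 n) z)%:E <=
  (M * (k / n%:R) `^ (k / n%:R))%:E.
Proof.
move=> n2; have n0 : (0 < n)%N by exact: ltnW.
set I := unit_ball_volume R n * \int[lebesgueRn n]_v (expR (- enorm v ^+ n))%:E.
have I0 : 0 <= I.
  apply: mule_ge0; first exact: unit_ball_volume_ge0.
  by apply: integral_ge0 => v _; rewrite lee_fin expR_ge0.
have Ioo : I < +oo.
  apply: lte_mul_pinfty; last exact: integral_expR_enormX_lty.
    exact: unit_ball_volume_ge0.
  exact: unit_ball_volume_fin_num.
(* The maximum with 1 is what gives M <= M^k for k >= 1. *)
exists (Num.max 1 (fine I))%R; first by rewrite le_max lexx.
move=> k k0; apply: (le_trans (moment_support_f0_le _ _ n2 k0)).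
rewrite -/I -(@fineK _ I) ?ge0_fin_numE// -EFinM lee_fin mulrC.
by rewrite ler_wpM2r ?powR_ge0// le_max lexx orbT.
Qed.

Theorem theorem1p3 (R : realType) (n : nat) (hn : n = 2%N \/ n = 3%N) :
  exists f0 : Rn R n * Rn R n -> R,
    [/\ forall z, (0 <= f0 z)%R,
        f0 \in Lfun (lebesgueRn n \x lebesgueRn n) 1,
        f0 \in Lfun (lebesgueRn n \x lebesgueRn n) +oo &
    [/\ exists m : R, (n%:R ^+ 2 - n%:R < m)%R /\
          \int[lebesgueRn n \x lebesgueRn n]_z
            (enorm z.2 `^ m * f0 z)%:E < +oo,
        exists C0 : R, (0 < C0)%R /\
          forall k : R, (1 <= k)%R ->
            \int[lebesgueRn n \x lebesgueRn n]_z
              (enorm z.2 `^ k * f0 z)%:E <= ((C0 * k) `^ (k / n%:R))%:E &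
        forall x : Rn R n,
          \int[lebesgueRn n]_v (f0 (x, v))%:E =
            unit_ball_volume R n * ln_neg (enorm x)]].
Proof.
have n2 : (2 <= n)%N by case: hn => ->.
have n0 : (0 < n)%N by exact: ltnW.
have n0R : (0 < n%:R :> R)%R by rewrite ltr0n.
have [M M1 Mle] := @ex_moment_support_f0_le R n n2.
have M0 : (0 < M)%R by exact: lt_le_trans M1.
have mf0 : measurable_fun setT (\1_(@support_f0 R n) : _ -> R).
  by apply: measurable_indic; exact: measurable_support_f0.
exists \1_(support_f0 n); split => [z|||]; first by [].
- apply/Lfun1_integrable/integrableP; split; first exact/measurable_EFinP.
  (* With 0 `^ 0 = 1 the moment of order 0 is the integral of f0. *)
  apply: le_lt_trans (ltry _); apply: le_trans (Mle 0%R (lexx _)).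
  rewrite le_eqVlt; apply/orP; left; apply/eqP/eq_integral => z _ /=.
  by rewrite powRr0 mul1r ger0_norm.
- rewrite inE; apply/andP; split; rewrite inE//= /finite_norm.
  rewrite unlock /Lnorm; case: ifPn => // _; apply: le_lt_trans (ltry 1%R).
  apply/ess_supP; apply: nearW => z /=.
  by rewrite lee_fin ger0_norm// indicE; case: (_ \in _).
split.
- exists (n%:R ^+ 2 - n%:R + 1)%R; split; first by rewrite ltrDl.
  apply: le_lt_trans (Mle _ _) (ltry _).
  rewrite addr_ge0// subr_ge0 expr2 ler_peMl ?ler1n//.
- (* (M^n k / n)^(k / n) = M^k (k / n)^(k / n). *)
  exists (M ^+ n / n%:R)%R; split; first by rewrite divr_gt0// exprn_gt0.
  move=> k k1; have k0 : (0 <= k)%R by exact: le_trans k1.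
  apply: le_trans (Mle k k0) _; rewrite lee_fin -mulrA [(_^-1 * k)%R]mulrC.
  rewrite [leRHS]powRM ?exprn_ge0 ?divr_ge0 ?(ltW M0)// ler_wpM2r ?powR_ge0//.
  rewrite -powR_mulrn ?(ltW M0)// -powRrM mulrCA divff ?gt_eqF// mulr1.
  exact: le1r_powR.
- by move=> x; exact: integral_support_f0_v.
Qed.
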